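(* Let $\kappa$ be a regular uncountable cardinal and $\lambda\ge\kappa$ a cardinal such that $\lambda=\mathrm{cf}([\lambda]^{<\kappa},\subseteq)$. Then every stationary subset of $[\lambda]^{<\kappa}$ contains an unbounded non-stationary subset.
   Context: $[\lambda]^{<\kappa}$ is the set of subsets of $\lambda$ of cardinality $<\kappa$, and $\mathrm{cf}([\lambda]^{<\kappa},\subseteq)$ is the minimal cardinality of a subset $\mathcal{U}\subseteq[\lambda]^{<\kappa}$ such that every member of $[\lambda]^{<\kappa}$ is contained in a member of $\mathcal{U}$. For a model $\mathcal{M}$ with universe $\lambda$ and countable vocabulary and $a\subseteq\lambda$, $\mathrm{cl}_{\mathcal{M}}(a)$ denotes the closure of $a$ under the functions (including constants) of $\mathcal{M}$. A club of $[\lambda]^{<\kappa}$ is a set of the form $\mathcal{C}_{\mathcal{M}}=\{a\in[\lambda]^{<\kappa}: a=\mathrm{cl}_{\mathcal{M}}(a)\ \wedge\ a\cap\kappa\in\kappa\}$ for some model $\mathcal{M}$ with universe $\lambda$ and countable vocabulary. The club filter $\mathcal{E}_{\lambda,\kappa}$ is the filter generated by the clubs. A set $S\subseteq[\lambda]^{<\kappa}$ is stationary if $[\lambda]^{<\kappa}\setminus S\notin\mathcal{E}_{\lambda,\kappa}$, and non-stationary otherwise. A set $S\subseteq[\lambda]^{<\kappa}$ is unbounded if every member of $[\lambda]^{<\kappa}$ is contained in some member of $S$. *)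

(* Defs.v *)
From HB Require Import structures.
From mathcomp Require Import all_boot all_order.
From mathcomp Require Import boolp classical_sets functions cardinality filter.
From mathcomp Require wochoice.

Set Implicit Arguments.
Unset Strict Implicit.
Unset Printing Implicit Defensive.

Import Order.TTheory.
Local Open Scope order_scope.
Local Open Scope classical_set_scope.
Local Open Scope card_scope.

(* The cardinal lambda is a well-ordered type L which is an initial ordinal,   *)
(* and the cardinal kappa <= lambda is an initial segment K of L which is an   *)
(* initial ordinal. The elements of an ordinal are the ordinals below it, so   *)
(* x : L stands for the ordinal [set y | y < x].                               *)

Definition card_lt (T U : Type) (A : set T) (B : set U) : Prop :=
  (A #<= B) /\ ~ (B #<= A).

Definition is_min_card (T U : Type) (P : set (set T)) (B : set U) : Prop :=
  (exists2 A, P A & (A #= B)) /\ (forall A, P A -> (B #<= A)).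

Section Cardinals.
Context {d : Order.disp_t} {L : orderType d}.
Implicit Types (K A : set L).

Definition initial_segment (x : L) : set L := [set y | y < x].

Definition is_ordinal K : Prop :=
  wochoice.well_order (<=%O : rel L) /\
  (forall x, K x -> initial_segment x `<=` K).

Definition is_cardinal K : Prop :=
  is_ordinal K /\ (forall x, K x -> card_lt (initial_segment x) K).

Definition cofinal_in K A : Prop :=
  A `<=` K /\ (forall x, K x -> exists2 y, A y & x <= y).

Definition is_regular_cardinal K : Prop :=
  [/\ is_cardinal K, infinite_set K & is_min_card (cofinal_in K) K].

End Cardinals.

Record vocabulary := Vocabulary {
  fun_symbol : countType;
  fun_arity : fun_symbol -> nat;
  rel_symbol : countType;
  rel_arity : rel_symbol -> nat }.

Record model (V : vocabulary) (T : Type) := Model {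
  fun_interp : forall f : fun_symbol V, (fun_arity f).-tuple T -> T;
  rel_interp : forall r : rel_symbol V, set ((rel_arity r).-tuple T) }.

Section Closure.
Context {V : vocabulary} {T : Type}.

(* Constants are the functions of arity 0. *)
Definition closed_under (M : model V T) (a : set T) : Prop :=
  forall (f : fun_symbol V) (t : (fun_arity f).-tuple T),
    (forall i, a (tnth t i)) -> a (fun_interp M t).

Definition cl (M : model V T) (a : set T) : set T := smallest (closed_under M) a.

End Closure.

Section Clubs.
Context {d : Order.disp_t} {L : orderType d}.
Implicit Types (K : set L) (C S : set (set L)).

Definition small_subsets K : set (set L) := [set a | card_lt a K].

Definition club_of_model K (V : vocabulary) (M : model V L) : set (set L) :=
  [set a | [/\ small_subsets K a, a = cl M a
             & exists2 x, K x & a `&` K = initial_segment x]].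

Definition club K C : Prop :=
  exists (V : vocabulary) (M : model V L), C = club_of_model K M.

(* The library's filters live on the whole type set L; the filter on           *)
(* [lambda]^{<kappa} consists of the members contained in [lambda]^{<kappa}.   *)
Definition club_filter K : set (set (set L)) :=
  [set X | X `<=` small_subsets K /\ smallest Filter (club K) X].

(* To be used for S included in small_subsets K. *)
Definition stationary K S : Prop := ~ club_filter K (small_subsets K `\` S).

Definition unbounded K S : Prop :=
  S `<=` small_subsets K /\
  (forall a, small_subsets K a -> exists2 b, S b & a `<=` b).

End Clubs.

(* Main.v *)
Require Import Defs.
From mathcomp Require Import all_boot all_order.
From mathcomp Require Import boolp classical_sets functions cardinality filter.

(** Let [u] run through a cofinal family in [lambda]^{<kappa} that is indexed
    by a subset of lambda. A stationary set [S] is unbounded, so for each index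
    [alpha] of a member [u] there is [s_alpha] in [S] that contains both [u] and
    the point [alpha], and there is a point [f alpha] outside [s_alpha].
    The set of all [s_alpha] is unbounded, and none of its members is closed
    under [f], so it avoids the club of the model (lambda, f). *)

Import Order.TTheory.
Local Open Scope order_scope.
Local Open Scope classical_set_scope.
Local Open Scope card_scope.

(** The point [u0] is the default value outside [A], which makes the injection a total function. *)
Lemma card_le_injection {T U : Type} (u0 : U) (A : set T) (B : set U) :
  A #<= B ->
  exists f : T -> U,
    (forall x, A x -> B (f x)) /\
    (forall x y, A x -> A y -> f x = f y -> x = y).
Proof.
move=> /card_leP/unsquash f.
pose g x := if pselect (A x) is left h then val (f (SigSub (mem_set h))) else u0.
exists g; split=> [x Ax|x y Ax Ay]; rewrite /g.
- by case: pselect => // h; exact: set_valP.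
- case: pselect => // h; case: pselect => // k /val_inj fxy.
  by have [] := @inj _ _ _ f _ _ (mem_set Logic.I) (mem_set Logic.I) fxy.
Qed.

Section UnaryModels.
Context {T : Type}.

(* [None] is the unary symbol, and [Some i] are constants indexed by [I]. *)
Definition unary_vocabulary (I : countType) : vocabulary :=
  @Vocabulary (option I) (fun i => if i is None then 1 else 0)%N
    void (fun=> 0%N).

Definition unary_model {I : countType} (f : T -> T) (c : I -> T) :
  model (unary_vocabulary I) T :=
  @Model (unary_vocabulary I) T
    (fun i => match i return
         (if i is None then 1 else 0)%N.-tuple T -> T with
       | None => fun t => f (thead t)
       | Some i => fun=> c i
       end)
    (fun r => match r with end).

Lemma closed_cl (V : vocabulary) (M : model V T) (a : set T) :
  closed_under M (cl M a).
Proof.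
move=> g t cl_t B B_aB; apply: (proj1 B_aB) => i.
exact: (cl_t i B B_aB).
Qed.

Lemma closed_unary_model {I : countType} {f : T -> T} {c : I -> T} {a} :
  closed_under (unary_model f c) a ->
  (forall x, a x -> a (f x)) /\ (forall i, a (c i)).
Proof.
move=> a_closed; split=> [x ax|i].
- by apply: (a_closed None [tuple x]) => i; rewrite (tnth_nth x) ord1.
- by apply: (a_closed (Some i) [tuple]) => -[].
Qed.

End UnaryModels.

Section Stationary.
Context {d : Order.disp_t} {L : orderType d}.
Implicit Types (K : set L) (S C : set (set L)).

Lemma sub_club_filter K C X :
  club K C -> C `<=` X -> X `<=` small_subsets K -> club_filter K X.
Proof.
move=> C_club CX X_small; split=> // F [F_filter /(_ C C_club)].
exact: filterS.
Qed.

Lemma club_of_model_small K (V : vocabulary) (M : model V L) :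
  club_of_model K M `<=` small_subsets K.
Proof. by move=> a []. Qed.

Lemma stationary_meets_model K S (V : vocabulary) (M : model V L) :
  stationary K S -> exists2 a, S a & club_of_model K M a.
Proof.
move=> S_stat; apply: contrapT => disjoint; apply: S_stat.
apply: (@sub_club_filter K (club_of_model K M)); first by exists V, M.
- move=> a Ca; split; first exact: club_of_model_small Ca.
  by move=> Sa; apply: disjoint; exists a.
- by move=> a [].
Qed.

(** Each member of a club is its own closure, hence closed, so the club of [M] is disjoint from
    [S]. *)
Lemma nonstationary_avoids_model K S (V : vocabulary) (M : model V L) :
  (forall a, S a -> ~ closed_under M a) -> ~ stationary K S.
Proof.
move=> S_open; apply; apply: (@sub_club_filter K (club_of_model K M)).
- by exists V, M.
- move=> a Ca; split; first exact: club_of_model_small Ca.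
  move=> /S_open; apply; case: Ca => _ -> _; exact: closed_cl.
- by move=> a [].
Qed.

(** Otherwise the image of [a] under [g] would be cofinal in [K], hence by regularity at least as
    large as [K]; but it is no larger than [a]. *)
Lemma regular_small_bounded {K} {a : set L} (g : L -> L) :
  is_regular_cardinal K -> small_subsets K a -> (forall x, a x -> K (g x)) ->
  exists2 m, K m & forall x, a x -> g x < m.
Proof.
move=> [_ _ [_ K_min]] [_ a_small] gK; apply: contrapT => unbounded_g.
apply: a_small; apply: card_le_trans (card_image_le g a).
apply: K_min; split=> [_ [x /gK gx <-] //|m Km].
apply: contrapT => bound_m; apply: unbounded_g; exists m => // x ax.
rewrite ltNge; apply/negP => m_le; apply: bound_m.
by exists (g x) => //; exists x.
Qed.

(* If [m] is a constant, then a member of the club contains all [x < m] in [K],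
   and the unary function maps this initial segment onto a superset of [a]. *)
Lemma stationary_has_superset_through K S (a : set L) (p : L) :
  is_regular_cardinal K -> stationary K S -> small_subsets K a ->
  exists s, [/\ S s, a `<=` s & s p].
Proof.
move=> K_reg S_stat a_small.
have [g [gK g_inj]] := card_le_injection p a K (proj1 a_small).
have [m Km g_lt] := regular_small_bounded g K_reg a_small gK.
have [f fg] : exists f : L -> L, forall x, a x -> f (g x) = x.
  (* Injectivity of [g] leaves at most one candidate in [a]; off the image of [a] the value is
     [p]. *)
  have /choice[f f_inv] y : exists x, forall z, a z -> g z = y -> x = z.
    have [[z az gz]|no_z] := pselect (exists2 z, a z & g z = y).
      by exists z => z' az' gz'; apply: g_inj; rewrite ?gz.
    by exists p => z az gz; case: no_z; exists z.
  by exists f => x ax; exact: f_inv.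
(* The second constant puts [p] into every member of the club. *)
pose M := unary_model f (fun b : bool => if b then p else m).
have [s Ss [_ s_cl [z Kz s_K]]] := stationary_meets_model K S _ M S_stat.
have s_closed : closed_under M s by rewrite s_cl; exact: closed_cl.
have [s_f s_c] := closed_unary_model s_closed.
exists s; split=> //; last exact: (s_c true).
move=> x ax; rewrite -(fg x ax); apply: s_f.
have m_z : m < z.
  have : (s `&` K) m by split=> //; exact: (s_c false).
  by rewrite s_K.
have : initial_segment z (g x) by exact: lt_trans (g_lt x ax) m_z.
by rewrite -s_K => -[].
Qed.

End Stationary.

Theorem theorem2p4 (d : Order.disp_t) (L : orderType d) (K : set L)
    (L_cardinal : is_cardinal [set: L])
    (K_regular : is_regular_cardinal K)
    (K_uncountable : ~ countable K)
    (cf_L : is_min_card (unbounded K) [set: L]) :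
  forall S : set (set L), S `<=` small_subsets K -> stationary K S ->
  exists T : set (set L), [/\ T `<=` S, unbounded K T & ~ stationary K T].
Proof.
move=> S S_small S_stat.
have [x0 Kx0] : K !=set0.
  by apply/set0P/eqP => K0; apply: K_uncountable; rewrite K0; exact: countable0.
have [[U [U_small U_cof] U_card] _] := cf_L.
have U_le : U #<= [set: L] by move: U_card; rewrite card_eq_le => /andP[].
(* The bound on the cofinality enters here: points of [L] serve as indices, so one unary function on
   [L] can handle all of [U]. *)
have [i [_ i_inj]] := card_le_injection x0 U [set: L] U_le.
have /choice[s s_spec] u : exists s, U u -> [/\ S s, u `<=` s & s (i u)].
  have [Uu|nUu] := pselect (U u); last by exists u.
  have [s s_u] := stationary_has_superset_through K S u (i u)
    K_regular S_stat (U_small _ Uu).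
  by exists s.
exists (s @` U); split.
- by move=> _ [u /s_spec[Ssu _ _] <-].
- split=> [_ [u /s_spec[Ssu _ _] <-]|a /U_cof[u Uu au]]; first exact: S_small.
  have [_ us _] := s_spec u Uu.
  by exists (s u); [exists u | exact: subset_trans us].
(* As [i] is injective on [U], at most one set has to be avoided at [alpha]; [x0] is the default at
   points that are not indices. *)
- have /choice[f f_out] alpha :
      exists beta, forall u, U u -> i u = alpha -> ~ s u beta.
    have [[u Uu iu]|no_u] := pselect (exists2 u, U u & i u = alpha); last first.
      by exists x0 => u Uu iu; case: no_u; exists u.
    have [Ssu _ _] := s_spec u Uu.
    have [_ K_big] := S_small _ Ssu.
    (* If [s u] were all of [L], it would include [K] and not be small. *)
    have [beta s_beta] : exists beta, ~ s u beta.
      apply/existsNP => s_full; apply: K_big.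
      by apply: subset_card_le => y _; exact: s_full.
    by exists beta => v Uv iv; rewrite (i_inj v u) // iv iu.
  (* The index type [void] gives a model without constants. *)
  apply: (nonstationary_avoids_model K _ _ (unary_model f (of_void L))).
  move=> _ [u Uu <-] /closed_unary_model[su_f _].
  (* The set [s u] contains its own index [i u] but misses [f (i u)]. *)
  have [_ _ s_iu] := s_spec u Uu.
  exact: f_out Uu erefl (su_f _ s_iu).
Qed.
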